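(* Let $n\geq 1$ and let $X_{1},X_{2},\ldots,X_n$ be symmetric independent identically distributed random variables with values in a separable Hilbert space $(\mathcal{H},|\cdot|)$, and let $S_k=\sum_{j=1}^k X_j$ for $1\leq k\leq n$. Then for any integer $i$ such that $\frac{n}{2}\leq i\leq n$, any positive real numbers $a_{i},\ldots,a_{n}$ and any $t\geq 0$, \[ \mathbb{P}\Big(\max_{i\leq k\leq n}\big||S_{k}|-a_{k}\big|\geq 19t\Big)\leq 6\max_{i\leq k\leq n}\mathbb{P}\big(\big||S_{k}|-a_{k}\big|\geq t\big). \]
   Context: The random variables are defined on a common probability space with probability measure $\mathbb{P}$. A random vector $X$ is symmetric if $X$ and $-X$ have the same distribution. $|x|$ denotes the norm of $x\in\mathcal{H}$. *)

(* Defs.v *)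
From HB Require Import structures.
From mathcomp Require Import all_boot all_order all_algebra.
From mathcomp Require Import all_classical all_reals all_analysis.

Set Implicit Arguments.
Unset Strict Implicit.
Unset Printing Implicit Defensive.

Import Order.TTheory GRing.Theory Num.Theory.
Import numFieldNormedType.Exports.

Local Open Scope classical_set_scope.
Local Open Scope ring_scope.

Definition separable_space (T : topologicalType) : Prop :=
  exists2 D : set T, countable D & dense D.

(* A Hilbert space is a complete normed space whose norm comes from an inner
   product; completeness is part of completeNormedModType. Complex Hilbert
   spaces are covered through their underlying real space, with inner product
   Re <x, y>, which has the same norm and Borel sets. *)
Definition hilbert_norm (R : realType) (H : completeNormedModType R) : Prop :=
  exists inner : {dot H for idfun}, forall x : H, `|x| = Num.sqrt (inner x x).

Notation borel_space T := (g_sigma_algebraType (@open T)).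

Section Laws.
Context (d d' : measure_display) (Omega : measurableType d)
  (E : measurableType d') (R : realType) (P : probability Omega R).

Definition same_law (X Y : Omega -> E) : Prop :=
  forall B : set E, measurable B -> pushforward P X B = pushforward P Y B.

Definition mutually_independent (I : finType) (X : I -> Omega -> E) : Prop :=
  forall (J : {set I}) (B : I -> set E), (forall j, measurable (B j)) ->
    P (\bigcap_(j in [set` J]) (X j @^-1` B j)) =
    (\prod_(j in J) P (X j @^-1` B j))%E.

End Laws.

Definition symmetric_vector (d : measure_display) (Omega : measurableType d)
    (R : realType) (P : probability Omega R) (H : normedModType R)
    (X : Omega -> borel_space H) : Prop :=
  same_law P X (fun w => - (X w : H)).

(* The family is indexed from 0, so X j is the (j+1)-st vector and
   partial_sum X k is the sum of the first k of them. *)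
Definition partial_sum (Omega : Type) (V : zmodType) (n : nat)
    (X : 'I_n -> Omega -> V) (k : nat) (w : Omega) : V :=
  \sum_(j < n | (j < k)%N) X j w.

(* Main.v *)
(** Let [p] be the maximum of the single probabilities; we may assume [p < 1/6].
For [i <= k <= n] put [Y = S_n - S_k], which is symmetric and independent of
[S_k].  The parallelogram law [|x + Y|^2 + |x - Y|^2 = 2 (|x|^2 + |Y|^2)],
applied at [x = S_k], shows that [|Y|^2] is within a multiple of
[(a_k + a_n) t] of [a_n^2 - a_k^2] with probability at least [1 - 3p].  Since
[Y] has at most [k] summands, [|Y|] is unlikely to exceed [a_k + t], which
forces [a_n <= 2 a_k + 3t].  Applied again at a point [x] with
[||x| - a_k| >= 19t], the parallelogram law then shows that for such [Y] one of
[|x + Y|], [|x - Y|] is at distance at least [t] from [a_n].  By symmetry, if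
[k] is the first index with [||S_k| - a_k| >= 19t], then
[||S_n| - a_n| >= t] with conditional probability at least
[(1 - 3p) / 2 >= 1/4]; summing over [k] gives the bound [4p]. *)
Require Import Defs.
From HB Require Import structures.
From mathcomp Require Import all_boot all_order all_algebra.
From mathcomp Require Import all_classical all_reals all_analysis.
From mathcomp Require Import measurable_realfun zify lra.

Import Order.TTheory GRing.Theory Num.Theory.
Import numFieldNormedType.Exports.

Local Open Scope classical_set_scope.
Local Open Scope ring_scope.

Set Implicit Arguments.
Unset Strict Implicit.

(** * Norm estimates from the parallelogram law *)

Lemma parallelogram (R : realType) (H : completeNormedModType R) (x y : H) :
  hilbert_norm H -> `|x + y| ^+ 2 + `|x - y| ^+ 2 = 2 * (`|x| ^+ 2 + `|y| ^+ 2).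
Proof.
move=> [f normE].
have f_ge0 z : 0 <= f z z.
  have [->|z0] := eqVneq z 0; last by rewrite ltW// neq0_dnorm_gt0.
  by rewrite linear0.
have sqE z : `|z| ^+ 2 = f z z by rewrite normE sqr_sqrtr.
rewrite !sqE (hnormD f) hnormB /=. lra.
Qed.

(* Here and below [x], [y], [u], [v] are the norms of two vectors, of their sum
   and of their difference, [a] and [b] the radii at times [k] and [n]. *)
Lemma typical_increment (R : realType) (a b t x y u v : R) :
  0 <= x -> 0 <= u -> 0 <= v ->
  u ^+ 2 + v ^+ 2 = 2 * (x ^+ 2 + y ^+ 2) ->
  `|x - a| < t -> `|u - b| < t -> `|v - b| < t ->
  Num.max 0 (b - t) ^+ 2 - (a + t) ^+ 2 <= y ^+ 2 <=
    (b + t) ^+ 2 - Num.max 0 (a - t) ^+ 2.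
Proof.
move=> x0 u0 v0 E; rewrite !ltr_norml => /andP[xl xu] /andP[ul uu] /andP[vl vu].
have sq_le (p q : R) : 0 <= p -> p <= q -> p ^+ 2 <= q ^+ 2.
  by move=> p0 pq; rewrite ler_sqr// nnegrE// (le_trans p0).
(* [b - t] and [a - t] may be negative; cutting them off at [0] keeps squaring monotone. *)
have m1 : Num.max 0 (b - t) ^+ 2 <= u ^+ 2.
  by apply: sq_le; rewrite ?ge_max ?le_max ?lexx//; lra.
have m2 : Num.max 0 (b - t) ^+ 2 <= v ^+ 2.
  by apply: sq_le; rewrite ?ge_max ?le_max ?lexx//; lra.
have m3 : Num.max 0 (a - t) ^+ 2 <= x ^+ 2.
  by apply: sq_le; rewrite ?ge_max ?le_max ?lexx//; lra.
have m4 : u ^+ 2 <= (b + t) ^+ 2 by apply: sq_le => //; lra.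
have m5 : v ^+ 2 <= (b + t) ^+ 2 by apply: sq_le => //; lra.
have m6 : x ^+ 2 <= (a + t) ^+ 2 by apply: sq_le => //; lra.
lra.
Qed.

(** If [u] and [v] were both within [t] of [b >= t], the identity would confine [x ^+ 2 + y ^+ 2] to
    a window of width [4 * b * t], at most [8 * a * t + 12 * t ^+ 2] by the bound on [b]. An [x] far
    from [a] puts the sum outside it. Cruder bounds settle [b < t]. *)
Lemma atypical_position (R : realType) (a b t x y u v : R) :
  0 <= x -> 0 <= u -> 0 <= v -> 0 < t -> 0 < a -> 0 < b ->
  u ^+ 2 + v ^+ 2 = 2 * (x ^+ 2 + y ^+ 2) ->
  b <= 2 * a + 3 * t -> 19 * t <= `|x - a| ->
  Num.max 0 (b - t) ^+ 2 - (a + t) ^+ 2 <= y ^+ 2 <=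
    (b + t) ^+ 2 - Num.max 0 (a - t) ^+ 2 ->
  t <= `|u - b| \/ t <= `|v - b|.
Proof.
move=> x0 u0 v0 t0 a0 b0 E ba + /andP[yl yu].
have [|ut] := leP t `|u - b|; first by left.
have [|vt] := leP t `|v - b|; first by right.
move: ut vt; rewrite !ltr_norml => /andP[ul uu] /andP[vl vu].
have sq_le (p q : R) : 0 <= p -> p <= q -> p ^+ 2 <= q ^+ 2.
  by move=> p0 pq; rewrite ler_sqr// nnegrE// (le_trans p0).
have sq_lt (p q : R) : 0 <= p -> p < q -> p ^+ 2 < q ^+ 2.
  by move=> p0 pq; rewrite ltr_sqr// nnegrE// (le_trans p0)// ltW.
have u2 : u ^+ 2 < (b + t) ^+ 2 by apply: sq_lt => //; lra.
have v2 : v ^+ 2 < (b + t) ^+ 2 by apply: sq_lt => //; lra.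
have at0 : 0 < a * t by rewrite mulr_gt0.
have tt0 : 0 < t * t by rewrite mulr_gt0.
have bt0 : 0 < b * t by rewrite mulr_gt0.
have bat : b * t <= 2 * (a * t) + 3 * (t * t).
  by rewrite !mulrA -mulrDl ler_pM2r//.
have [xa|xa] := leP 0 (x - a);
  [rewrite ger0_norm// => far|rewrite ltr0_norm// => far].
(* Outer side: for [b >= t] the sum is at least [(b - t) ^+ 2 + 36 * a * t + 360 * t ^+ 2], beyond
   [(b + t) ^+ 2]. *)
- exfalso.
  have x2 : (a + 19 * t) ^+ 2 <= x ^+ 2 by apply: sq_le; lra.
  have [bt|bt] := leP 0 (b - t).
    move: yl; rewrite max_r// => yl.
    move: u2 v2 x2 yl; rewrite !expr2 => *; lra.
  have b2 : (b + t) ^+ 2 < (2 * t) ^+ 2 by apply: sq_lt; lra.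
  have := sqr_ge0 y.
  have := sqr_ge0 a; move: u2 v2 x2 b2 E; rewrite !expr2 => *; lra.
(* Inner side: [x >= 0] forces [a >= 19 * t], so [a * t] dominates [t * t]. The sum is at most
   [(b + t) ^+ 2 - 36 * a * t + 360 * t ^+ 2], which for [b >= t] is below [(b - t) ^+ 2]. *)
- exfalso.
  have ta : 19 * t <= a by lra.
  have x2 : x ^+ 2 <= (a - 19 * t) ^+ 2 by apply: sq_le; lra.
  have att : 19 * (t * t) <= a * t by rewrite mulrA ler_pM2r.
  move: yu; rewrite max_r => [yu|]; last by lra.
  have [bt|bt] := leP 0 (b - t).
    have u3 : (b - t) ^+ 2 <= u ^+ 2 by apply: sq_le; lra.
    have v3 : (b - t) ^+ 2 <= v ^+ 2 by apply: sq_le; lra.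
    move: u3 v3 x2 yu E; rewrite !expr2 => *; lra.
  have b2 : (b + t) ^+ 2 < (2 * t) ^+ 2 by apply: sq_lt; lra.
  have a2 : (18 * t) ^+ 2 <= (a - t) ^+ 2 by apply: sq_le; lra.
  have := sqr_ge0 y.
  move: yu b2 a2; rewrite !expr2 => *; lra.
Qed.

(** * Borel measurability of the vector operations *)

Lemma measurable_normv (R : realType) (H : normedModType R) :
  measurable_fun setT (fun x : borel_space H => `|x : H| : R).
Proof.
apply: (@measurability _ _ (borel_space H) (measurableTypeR R) setT _ _ (RGenOpens.measurableE R)).
move=> _ [_ [p [q ->]] <-]; rewrite setTI; apply: sub_sigma_algebra.
by apply: open_comp => [x _|]; [exact: norm_continuous|exact: interval_open].
Qed.

Lemma measurable_oppv (R : realType) (H : normedModType R) :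
  measurable_fun setT (fun x : borel_space H => - (x : H) : borel_space H).
Proof.
apply: (@measurability _ _ (borel_space H) (borel_space H) setT _ (@open H) erefl) => _ [U oU <-]; rewrite setTI.
apply: sub_sigma_algebra.
by move: U oU; apply/continuousP => x; exact: opp_continuous.
Qed.

(** Continuity of addition makes the preimage of an open set a union of boxes; separability makes
    the union countable, with centres in a dense set and radii [1 / (m + 1)]. *)
Lemma measurable_addv (R : realType) (H : normedModType R) d
    (T : measurableType d) (f g : T -> borel_space H) :
  separable_space H -> measurable_fun setT f -> measurable_fun setT g ->
  measurable_fun setT (fun x => (f x : H) + (g x : H) : borel_space H).
Proof.
move=> [D cD dD] mf mg.
apply: (@measurability _ _ T (borel_space H) setT _ (@open H) erefl) => _ [U oU <-]; rewrite setTI.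
have tri (u p x v q y : H) (r : R) : `|u - p| < r -> `|p - x| < r ->
    `|v - q| < r -> `|q - y| < r -> `|u + v - (x + y)| < 4 * r.
  move=> up px vq qy.
  have -> : u + v - (x + y) = (u - p + (p - x)) + (v - q + (q - y)).
    by rewrite opprD addrACA !addrA !subrK.
  have := ler_normD (u - p + (p - x)) (v - q + (q - y)).
  have := ler_normD (u - p) (p - x).
  have := ler_normD (v - q) (q - y).
  lra.
pose box (q : (H * H) * nat) : set T :=
  f @^-1` ball q.1.1 q.2.+1%:R^-1 `&` g @^-1` ball q.1.2 q.2.+1%:R^-1.
pose Q := (D `*` D `*` [set: nat]) `&`
  [set q : (H * H) * nat | forall x y, ball q.1.1 q.2.+1%:R^-1 x ->
     ball q.1.2 q.2.+1%:R^-1 y -> U (x + y)].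
have -> : (fun x => (f x : H) + (g x : H)) @^-1` U = \bigcup_(q in Q) box q.
  apply/seteqP; split => [w /= Uw|w [[[p q] m] [_ UQ] [fw gw]]]; last exact: UQ fw gw.
  have [e /= e0 Ue] : nbhs_ball (f w + g w : H) U.
    by apply/nbhs_ballP; exact: open_nbhs_nbhs.
  (* Radii below [e / 4] suffice, since [tri] loses a factor [4]. *)
  have e4 : 0 < e / 4 by rewrite divr_gt0.
  pose m := Num.trunc (e / 4)^-1.
  have me : m.+1%:R^-1 < e / 4.
    by rewrite invf_plt ?posrE ?ltr0n// truncnS_gt.
  have [p [Bp Dp]] : (ball (f w : H) m.+1%:R^-1 `&` D) !=set0.
    by apply: dD; [exists (f w); exact: ballxx|exact: ball_open].
  have [q [Bq Dq]] : (ball (g w : H) m.+1%:R^-1 `&` D) !=set0.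
    by apply: dD; [exists (g w); exact: ballxx|exact: ball_open].
  exists ((p, q), m); last by split; exact: ball_sym.
  split => //= x y Bx By; apply: Ue.
  move: Bx By Bp Bq; rewrite -!ball_normE /= => Bx By Bp Bq.
  by apply: lt_le_trans (tri _ _ _ _ _ _ _ Bp Bx Bq By) _; rewrite -ler_pdivlMl// mulrC ltW.
have cQ : countable Q.
  apply: sub_countable (countableX (countableX cD cD) (countableP [set: nat])).
  by apply: subset_card_le => q [].
have mbox b : measurable (box b).
  apply: measurableI; rewrite -[X in measurable X]setTI.
    by apply: mf => //; apply: sub_sigma_algebra; exact: ball_open.
  by apply: mg => //; apply: sub_sigma_algebra; exact: ball_open.
have /pfcard_geP[->|[h]] := cQ; first by rewrite bigcup_set0.
rewrite -(image_eq h) bigcup_image; exact: bigcupT_measurable.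
Qed.

(* The sigma-algebra generated by [cylinder J] consists of the events that
   depend only on the coordinates in [J]. *)
Definition cylinder (I : finType) d (E : measurableType d) (J : {set I}) :
    set_system (I -> E) :=
  [set C | exists2 B : I -> set E, (forall j, measurable (B j)) &
     C = [set x | forall j, j \in J -> B j (x j)]].

(** * Cylinder sigma-algebras *)

Section cylinders.
Context {I : finType} {d : measure_display} {E : measurableType d}.
Implicit Types J K : {set I}.

Lemma cylinderI J : setI_closed (cylinder (E := E) J).
Proof.
move=> _ _ [B mB ->] [B' mB' ->]; exists (fun j => B j `&` B' j).
  by move=> j; exact: measurableI.
apply/seteqP; split => [x [xB xB'] j Jj|x xBB']; first by split; auto.
by split=> j /xBB'[].
Qed.

Lemma cylinderT J : cylinder J [set: I -> E].
Proof. by exists (fun=> setT) => //; apply/seteqP; split. Qed.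

Lemma cylinder_sub J K : J \subset K -> cylinder (E := E) J `<=` cylinder K.
Proof.
move=> /fintype.subsetP JK _ [B mB ->]; exists (fun j => if j \in J then B j else setT).
  by move=> j; case: ifP.
apply/seteqP; split => x xB j jK; first by case: ifP => // /xB.
by have := xB j (JK _ jK); rewrite jK.
Qed.

Lemma measurable_cylinder_sub J K (C : set (I -> E)) : J \subset K ->
  (cylinder J).-sigma.-measurable C -> (cylinder K).-sigma.-measurable C.
Proof.
move=> JK; apply: sub_smallest2r; first exact: smallest_sigma_algebra.
exact: cylinder_sub.
Qed.

Lemma measurable_coord J j : j \in J ->
  measurable_fun setT (fun x : g_sigma_algebraType (cylinder (E := E) J) => x j).
Proof.
move=> Jj _ B mB; rewrite setTI; apply: sub_sigma_algebra.
exists (fun k => if k == j then B else setT) => [k|]; first by case: ifP.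
apply/seteqP; split => [x xB k Jk|x /(_ j Jj)]; last by rewrite eqxx.
by case: eqP => // ->.
Qed.

Lemma measurable_family d' (T : measurableType d') J
    (f : T -> I -> E) :
  (forall j, j \in J -> measurable_fun setT (f ^~ j)) ->
  measurable_fun setT (f : T -> g_sigma_algebraType (cylinder J)).
Proof.
move=> mf; apply: (@measurability _ _ T (g_sigma_algebraType (cylinder J)) setT f (cylinder J) erefl).
move=> _ [_ [B mB ->] <-]; rewrite setTI.
have -> : f @^-1` [set x | forall j, j \in J -> B j (x j)] =
    \bigcap_(j in [set` J]) ((f ^~ j) @^-1` B j).
  by apply/seteqP; split.
apply: fin_bigcap_measurable => // j Jj.
by rewrite -[X in measurable X]setTI; exact: mf.
Qed.

End cylinders.

(** The sets equal to their preimage under [g] form a sigma-algebra containing the cylinders over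
    [J]. The case of interest is [flip_from k], which fixes the first [k] coordinates. *)
Lemma preimage_fix_coords (I : finType) d (E : measurableType d) (J : {set I})
    (g : (I -> E) -> I -> E) (C : set (I -> E)) :
  (forall x j, j \in J -> g x j = x j) ->
  (cylinder J).-sigma.-measurable C -> g @^-1` C = C.
Proof.
move=> gJ; suff: <<s cylinder J >> `<=` [set C : set (I -> E) | g @^-1` C = C] by exact.
apply: smallest_sub; first split.
- by rewrite /= preimage_set0.
- by move=> A /= gA; rewrite setTD -[in RHS]gA.
- by move=> F /= gF; rewrite preimage_bigcup; apply: eq_bigcupr => k _; exact: gF.
move=> _ [B mB ->]; apply/seteqP; split => x xB j jJ; have := xB j jJ; by rewrite gJ.
Qed.

(** * Extension from cylinders to the generated sigma-algebra *)

Section law_on_cylinders.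
Context {I : finType} {d d' : measure_display} {E : measurableType d}
  {T : measurableType d'} {R : realType} (P : probability T R).
Implicit Types (J K : {set I}).

(** Cylinders form a pi-system containing the whole space, so they determine a finite measure. *)
Lemma eq_law_cylinders J (f g : T -> I -> E) :
  (forall j, j \in J -> measurable_fun setT (f ^~ j)) ->
  (forall j, j \in J -> measurable_fun setT (g ^~ j)) ->
  (forall C, cylinder J C -> P (f @^-1` C) = P (g @^-1` C)) ->
  forall C, (cylinder J).-sigma.-measurable C -> P (f @^-1` C) = P (g @^-1` C).
Proof.
move=> mf mg fg C mC.
pose F : {RV P >-> g_sigma_algebraType (cylinder J)} :=
  mfun_Sub (mem_set (measurable_family mf)).
pose G : {RV P >-> g_sigma_algebraType (cylinder J)} :=
  mfun_Sub (mem_set (measurable_family mg)).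
rewrite -[LHS]/(distribution P F C) -[RHS]/(distribution P G C).
apply: (@measure_unique _ R (g_sigma_algebraType (cylinder J)) (cylinder J) (fun=> setT) erefl
  (@cylinderI _ _ _ J) (fun=> cylinderT J) _
  (distribution P F) (distribution P G)) => //.
- by apply/seteqP; split => // x _; exists 0%N.
- by move=> _; rewrite ltey_eq fin_num_measure.
Qed.

(** For fixed [D], the events obeying the product rule form a Dynkin system. *)
Lemma indep_cylinders J (f : T -> I -> E) (D : set T) :
  (forall j, j \in J -> measurable_fun setT (f ^~ j)) -> measurable D ->
  (forall C, cylinder J C -> P (f @^-1` C `&` D) = (P (f @^-1` C) * P D)%E) ->
  forall C, (cylinder J).-sigma.-measurable C ->
    P (f @^-1` C `&` D) = (P (f @^-1` C) * P D)%E.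
Proof.
move=> mf mD indep C mC.
have mpre B : (cylinder J).-sigma.-measurable B -> measurable (f @^-1` B).
  by move=> mB; rewrite -[X in measurable X]setTI; exact: measurable_family.
apply: (@dynkin_induction _ (g_sigma_algebraType (cylinder J)) (cylinder J)
  (fun C => P (f @^-1` C `&` D) = (P (f @^-1` C) * P D)%E)) => //.
- exact: cylinderI.
- by rewrite preimage_setT setTI probability_setT mul1e.
- move=> S mS PS; rewrite [f @^-1` (~` S)]preimage_setC setIC -setDE.
  have mS' := mpre _ mS.
  rewrite measureD//; last by rewrite ltey_eq fin_num_measure.
  transitivity (P D - P (f @^-1` S `&` D))%E; first by rewrite [in RHS]setIC.
  rewrite PS probability_setC// muleBl ?fin_num_measure ?mul1e//.
- move=> F mF tF PF; rewrite preimage_bigcup setI_bigcupl.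
  have tpre : trivIset setT (fun k => f @^-1` F k).
    apply/trivIsetP => k l _ _ kl; rewrite -preimage_setI.
    by move/trivIsetP : tF => /(_ k l Logic.I Logic.I kl) ->; rewrite preimage_set0.
  rewrite !measure_bigcup//; last 3 first.
  + by move=> k _; exact: mpre.
  + by move=> k _; apply: measurableI => //; exact: mpre.
  + by apply: trivIset_setIr.
  rewrite muleC -(fineK (fin_num_measure P D mD)) -nneseriesZl//.
  apply: eq_eseriesr => k _; rewrite fineK ?fin_num_measure// muleC; exact: PF.
Qed.

End law_on_cylinders.

(** * Joint laws of independent families *)

Section independent_families.
Context {I : finType} {d d' : measure_display} {E : measurableType d}
  {T : measurableType d'} {R : realType} (P : probability T R).
Implicit Types (J K : {set I}) (X Y : I -> T -> E).

Let joint X (w : T) (j : I) : E := X j w.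

Lemma prob_cylinder X J (B : I -> set E) : mutually_independent P X ->
  (forall j, measurable (B j)) ->
  P (joint X @^-1` [set x | forall j, j \in J -> B j (x j)]) =
  (\prod_(j in J) P (X j @^-1` B j))%E.
Proof. by move=> indepX mB; rewrite -indepX. Qed.

Lemma mutually_independent_comp X (g : I -> E -> E) :
  (forall j, measurable_fun setT (g j)) -> mutually_independent P X ->
  mutually_independent P (fun j w => g j (X j w)).
Proof.
move=> mg indepX J B mB; rewrite -(indepX J (fun j => g j @^-1` B j))// => j.
by rewrite -[X in measurable X]setTI; exact: mg.
Qed.

Lemma mutually_independent_reindex X (s : I -> I) : involutive s ->
  mutually_independent P X -> mutually_independent P (fun j => X (s j)).
Proof.
move=> sK indepX J B mB.
(* Independence of [X] is used on the image of [J], where the element [s k] must carry the set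
   [B k]. *)
have := indepX (s @: J)%SET (fun j => B (s j)) (fun j => mB _).
rewrite big_imset /=; last by move=> ? ? _ _ /(inv_inj sK).
under eq_bigr do rewrite sK.
move=> <-; congr (P _); apply/seteqP; split => w /= XB j jJ.
  by case/imsetP : jJ => k kJ ->; rewrite sK; exact: XB.
by have := XB (s j); rewrite sK; apply; apply: imset_f.
Qed.

(** Independence makes the probability of a cylinder a product of marginals, which agree for the two
    families. This yields invariance of the joint law under sign flips and reversal. *)
Lemma eq_joint_law X Y C :
  (forall j, measurable_fun setT (X j)) -> (forall j, measurable_fun setT (Y j)) ->
  mutually_independent P X -> mutually_independent P Y ->
  (forall j, same_law P (X j) (Y j)) ->
  (cylinder (E := E) [set: I]%SET).-sigma.-measurable C ->
  P (joint X @^-1` C) = P (joint Y @^-1` C).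
Proof.
move=> mX mY indepX indepY XY.
apply: (@eq_law_cylinders _ _ _ _ _ _ _ [set: I]%SET).
- by move=> j _; exact: mX.
- by move=> j _; exact: mY.
move=> {}C [B mB ->].
by rewrite !prob_cylinder//; apply: eq_bigr => j _; exact: XY.
Qed.

(** The Dynkin argument is run once per block, which reduces the claim to two cylinders; over
    disjoint blocks these intersect in a single cylinder. *)
Lemma indep_blocks X J K C D : (forall j, measurable_fun setT (X j)) ->
  mutually_independent P X -> [disjoint J & K]%B ->
  (cylinder (E := E) J).-sigma.-measurable C ->
  (cylinder (E := E) K).-sigma.-measurable D ->
  P (joint X @^-1` C `&` joint X @^-1` D) =
  (P (joint X @^-1` C) * P (joint X @^-1` D))%E.
Proof.
move=> mX indepX JK mC mD.
have mpre L B : (cylinder (E := E) L).-sigma.-measurable B ->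
    measurable (joint X @^-1` B).
  move=> mB; rewrite -[X in measurable X]setTI.
  exact: (measurable_family (J := L) (f := joint X) (fun j _ => mX j)).
move: C mC; apply: indep_cylinders => [j _||C cC]; [exact: mX|exact: mpre mD|].
rewrite setIC muleC; move: D mD; apply: indep_cylinders => [j _||D cD].
- exact: mX.
- by apply: (mpre J); exact: sub_sigma_algebra.
case: cC cD => [B mB ->] [B' mB' ->].
rewrite !prob_cylinder//.
(* The two families of sets are glued; disjointness ensures that [B'] is kept on all of [K]. *)
pose B'' j := if j \in J then B j else B' j.
have mB'' j : measurable (B'' j) by rewrite /B''; case: ifP.
have nJ j : j \in K -> (j \in J) = false.
  by move=> jK; apply/negP => jJ; move/disjointFr : JK => /(_ _ jJ); rewrite jK.
transitivity (P (joint X @^-1` [set x | forall j, j \in J :|: K -> B'' j (x j)])).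
  congr (P _); apply/seteqP; split => w /=.
    move=> [wK wJ] j; rewrite inE /B''; case: ifPn => [jJ _|jJ /= jK]; first exact: wJ.
    exact: wK.
  move=> wB; split => j jJ; have := wB j; rewrite inE /B'' jJ ?orbT.
    by rewrite nJ//; apply.
  by apply.
rewrite prob_cylinder// (eq_bigl [predU J & K]); last by move=> j; rewrite !inE.
rewrite bigU//= [RHS]muleC; congr (_ * _)%E; apply: eq_bigr => j jJ.
  by rewrite /B'' jJ.
by rewrite /B'' nJ.
Qed.

End independent_families.

(** * Borel sets of radii *)

Section shells.
Context {R : realType}.

Lemma measurable_shell (c b : R) : measurable [set r : R | c <= `|r - b|].
Proof.
have -> : [set r : R | c <= `|r - b|] = ~` ball b c.
  apply/seteqP; split => r; rewrite -ball_normE /= distrC.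
    by move=> cr; apply/negP; rewrite -leNgt.
  by move/negP; rewrite -leNgt.
by apply: measurableC; exact: measurable_ball.
Qed.

Lemma measurable_sqr_itv (l u : R) : measurable [set r : R | l <= r ^+ 2 <= u].
Proof.
have -> : [set r : R | l <= r ^+ 2 <= u] = (fun r => r ^+ 2) @^-1` `[l, u].
  by apply/seteqP; split => r; rewrite /= in_itv.
rewrite -[X in measurable X]setTI; apply: (exprn_measurable 2) => //.
Qed.

End shells.

(** * Sums along a path, sign flips and reversal *)

Section partial_sums.
Context {R : realType} {H : completeNormedModType R} {n : nat}.
Implicit Types (x : 'I_n -> H) (k m : nat).

Definition head_sum k x : H := \sum_(j < n | (j < k)%N) x j.
Definition tail_sum k x : H := \sum_(j < n | ~~ (j < k)%N) x j.
(** Reflection of the walk after time [k]: later increments change sign, earlier positions stay. *)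
Definition flip_from k x (j : 'I_n) : H := if (j < k)%N then x j else - x j.
Definition reverse x (j : 'I_n) : H := x (rev_ord j).

Lemma head_tail_sum k x : head_sum n x = head_sum k x + tail_sum k x.
Proof.
rewrite /head_sum (bigID (fun j : 'I_n => (j < k)%N))/=.
by congr (_ + _); apply: eq_bigl => j; rewrite ltn_ord.
Qed.

Lemma head_sum_flip k m x : (m <= k)%N ->
  head_sum m (flip_from k x) = head_sum m x.
Proof.
move=> mk; apply: eq_bigr => j jm.
by rewrite /flip_from (leq_trans jm mk).
Qed.

Lemma tail_sum_flip k x : tail_sum k (flip_from k x) = - tail_sum k x.
Proof.
rewrite /tail_sum -sumrN; apply: eq_bigr => j jk.
by rewrite /flip_from (negbTE jk).
Qed.

(** The right-hand side is the mirror image of the sum at time [k] about the sum at time [m], so the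
    latter is their midpoint. *)
Lemma head_sum_flipS m k x : (m <= k)%N ->
  head_sum k (flip_from m x) = head_sum m x - (head_sum k x - head_sum m x).
Proof.
have split_sum (y : 'I_n -> H) : (m <= k)%N ->
    head_sum k y = head_sum m y + \sum_(j < n | (j < k)%N && ~~ (j < m)%N) y j.
  move=> mk; rewrite /head_sum (bigID (fun j : 'I_n => (j < m)%N))/=.
  congr (_ + _); apply: eq_bigl => j.
  by rewrite andbC; case: ltnP => //= jm; rewrite (leq_trans jm mk).
move=> mk; rewrite split_sum// head_sum_flip// [in RHS]split_sum// addrAC subrr add0r.
congr (_ + _); rewrite -sumrN; apply: eq_bigr => j /andP[_ jm].
by rewrite /flip_from (negbTE jm).
Qed.

(** Under a reversal-invariant law, the tail is thus distributed as an initial sum of [n - k] terms,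
    at most [k] of them when [n <= 2 * k]. *)
Lemma tail_sum_reverse k x : (k <= n)%N ->
  tail_sum k (reverse x) = head_sum (n - k) x.
Proof.
move=> kn; rewrite /tail_sum /head_sum (reindex_inj rev_ord_inj)/=.
apply: eq_big => [j|j _]; last by rewrite /reverse rev_ordK.
(* [rev_ord j] is [n - j.+1], and [k <= n - j.+1] means [j < n - k]. *)
by rewrite -leqNgt /=; have := ltn_ord j; lia.
Qed.

End partial_sums.

(** * Measurability of events about sums *)

Section measurable_partial_sums.
Context {R : realType} {H : completeNormedModType R} {n : nat}.
Hypothesis separableH : separable_space H.

Lemma measurable_sumv d (T : measurableType d) (I : Type) (s : seq I)
    (Q : pred I) (f : I -> T -> borel_space H) :
  (forall j, Q j -> measurable_fun setT (f j)) ->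
  measurable_fun setT (fun w => \sum_(j <- s | Q j) (f j w : H) : borel_space H).
Proof.
move=> mf; elim: s => [|j s IH].
  apply: (@eq_measurable_fun _ _ T (borel_space H) setT (cst (0 : H))); last exact: measurable_cst.
  by move=> w _; rewrite big_nil.
have [Qj|nQj] := boolP (Q j).
  apply: (@eq_measurable_fun _ _ T (borel_space H)) (measurable_addv separableH (mf _ Qj) IH) => w _.
  by rewrite big_cons Qj.
by apply: (@eq_measurable_fun _ _ T (borel_space H)) IH => w _; rewrite big_cons (negbTE nQj).
Qed.

(** Keeping [J] as a parameter places the event in the sigma-algebra of the coordinates it involves,
    as block independence requires. *)
Lemma measurable_norm_sum (J : {set 'I_n}) (Q : pred 'I_n) (A : set R) :
  (forall j, Q j -> j \in J) -> measurable A ->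
  (cylinder (E := borel_space H) J).-sigma.-measurable
    [set x | A `|\sum_(j < n | Q j) (x j : H)|].
Proof.
move=> QJ mA.
have mcoord j : Q j -> measurable_fun setT
    (fun x : g_sigma_algebraType (cylinder (E := borel_space H) J) => x j).
  by move=> /QJ; exact: measurable_coord.
have := measurableT_comp (@measurable_normv R H)
  (measurable_sumv (index_enum 'I_n) mcoord).
by move=> /(_ measurableT _ mA); rewrite setTI.
Qed.

Lemma measurable_flip k (C : set ('I_n -> borel_space H)) :
  (cylinder [set: 'I_n]%SET).-sigma.-measurable C ->
  (cylinder [set: 'I_n]%SET).-sigma.-measurable [set x : 'I_n -> borel_space H | C (flip_from k x)].
Proof.
move=> mC.
have mflip : measurable_fun setT
    (flip_from k : g_sigma_algebraType (cylinder (E := borel_space H) [set: 'I_n]%SET) ->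
      g_sigma_algebraType (cylinder (E := borel_space H) [set: 'I_n]%SET)).
  apply: measurable_family => j _.
  have mj := @measurable_coord _ _ (borel_space H) _ _ (finset.in_setT j).
  rewrite /flip_from; case: (j < k)%N => //.
  exact: (measurableT_comp (@measurable_oppv R H) mj).
by have := mflip measurableT C mC; rewrite setTI.
Qed.

End measurable_partial_sums.

(** * Probabilities as real numbers *)

Section real_probability.
Context {d : measure_display} {T : measurableType d} {R : realType}
  (P : probability T R).
Implicit Types A B : set T.

Lemma le_fine_prob A B : measurable A -> measurable B -> A `<=` B ->
  fine (P A) <= fine (P B).
Proof.
by move=> mA mB AB; rewrite fine_le ?fin_num_measure// le_measure ?inE.
Qed.

Lemma fine_probU A B : measurable A -> measurable B ->
  fine (P (A `|` B)) <= fine (P A) + fine (P B).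
Proof.
move=> mA mB; rewrite -fineD ?fin_num_measure//.
rewrite fine_le ?fin_numD ?fin_num_measure ?measureU2//.
exact: measurableU.
Qed.

Lemma fine_probC A : measurable A -> fine (P (~` A)) = 1 - fine (P A).
Proof.
by move=> mA; rewrite probability_setC// fineB ?fin_num_measure.
Qed.

Lemma fine_prob_bigsetU (F : nat -> set T) m :
  (forall k, measurable (F k)) -> trivIset setT F ->
  fine (P (\big[setU/set0]_(k < m) F k)) = \sum_(k < m) fine (P (F k)).
Proof.
move=> mF tF; rewrite measure_bigsetU// sum_fine// => k _.
exact: fin_num_measure.
Qed.

End real_probability.

(** * The maximal inequality on path space *)

Section maximal_inequality.
Context {R : realType} {H : completeNormedModType R} {n : nat}.
Hypotheses (hilbertH : hilbert_norm H) (separableH : separable_space H).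
Local Notation space J := (g_sigma_algebraType (cylinder (E := borel_space H) J)).
Local Notation full := [set: 'I_n]%SET.
(** The joint law enters only through three properties: invariance under sign flips, invariance
    under reversal, and independence of disjoint blocks. *)
Variable mu : probability (space full) R.
Hypothesis mu_flip : forall k (C : set ('I_n -> borel_space H)),
  (cylinder full).-sigma.-measurable C ->
  mu [set x : 'I_n -> borel_space H | C (flip_from k x)] = mu C.
Hypothesis mu_reverse : forall C : set ('I_n -> borel_space H),
  (cylinder full).-sigma.-measurable C ->
  mu [set x : 'I_n -> borel_space H | C (reverse x)] = mu C.
Hypothesis mu_indep : forall (J K : {set 'I_n}) (C D : set ('I_n -> borel_space H)),
  [disjoint J & K]%B ->
  (cylinder J).-sigma.-measurable C -> (cylinder K).-sigma.-measurable D ->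
  mu (C `&` D) = (mu C * mu D)%E.
Variables (a : nat -> R) (t p : R).
Hypothesis t_gt0 : 0 < t.
Hypothesis p_small : p < 1 / 6.
Let pr (C : set ('I_n -> borel_space H)) : R := fine (mu C).
Let dev k (c : R) : set ('I_n -> borel_space H) :=
  [set x | c <= `| `|head_sum k x| - a k|].

Lemma measurable_dev (J : {set 'I_n}) k (c : R) :
  (forall j : 'I_n, (j < k)%N -> j \in J) ->
  (cylinder J).-sigma.-measurable (dev k c).
Proof.
by move=> kJ; exact: (measurable_norm_sum separableH kJ (measurable_shell c (a k))).
Qed.

Let mdev k c : (cylinder full).-sigma.-measurable (dev k c).
Proof. by apply: measurable_dev => j _; exact: finset.in_setT. Qed.

Let mnorm (Q : pred 'I_n) (A : set R) : measurable A ->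
  (cylinder full).-sigma.-measurable
    [set x : 'I_n -> borel_space H | A `|\sum_(j < n | Q j) (x j : H)|].
Proof.
by move=> mA; apply: measurable_norm_sum => // j _; exact: finset.in_setT.
Qed.

Let mray (c : R) : measurable [set r : R | c <= r].
Proof.
have -> : [set r : R | c <= r] = `[c, +oo[%classic by apply/seteqP; split => r; rewrite /= in_itv/= andbT.
exact: measurable_itv.
Qed.

Let mbig k c : (cylinder full).-sigma.-measurable
  [set x : 'I_n -> borel_space H | c <= `|head_sum k x|].
Proof. exact: mnorm (mray c). Qed.

(** A Lévy-type inequality: the sum at time [m] is the midpoint of the sum at time [k] and its
    mirror image, which have the same law, and one of the two has norm at least that of the
    midpoint. *)
Lemma prob_head_sum_mono m k c : (m <= k)%N ->
  pr [set x : 'I_n -> borel_space H | c <= `|head_sum m x|] <=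
  2 * pr [set x : 'I_n -> borel_space H | c <= `|head_sum k x|].
Proof.
move=> mk.
pose C : set ('I_n -> borel_space H) := [set x | c <= `|head_sum k x|].
pose C' : set ('I_n -> borel_space H) := [set x | C (flip_from m x)].
have mC' : (cylinder full).-sigma.-measurable C'.
  by apply: measurable_flip => //; exact: mbig.
have -> : 2 * pr C = pr C + pr C'.
  by rewrite /pr mu_flip//; [lra|exact: mbig].
apply: le_trans (fine_probU mu (mbig k c) mC').
apply: le_fine_prob; [exact: mbig|exact: measurableU (mbig k c) mC'|].
move=> x /= cx; rewrite /C' /C /= head_sum_flipS//.
have [|kc] := leP c `|head_sum k x|; first by left.
have [|kc'] := leP c `|head_sum m x - (head_sum k x - head_sum m x)|; first by right.
exfalso; have := ler_normD (head_sum k x) (head_sum m x - (head_sum k x - head_sum m x)).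
have -> : head_sum k x + (head_sum m x - (head_sum k x - head_sum m x)) =
    head_sum m x *+ 2.
  by rewrite opprB addrCA [head_sum k x + _]addrC subrK mulr2n.
by rewrite normrMn mulr2n; lra.
Qed.

Section one_step.
Variable k : nat.
Hypotheses (kn : (k <= n)%N) (nk : (n <= 2 * k)%N).
Hypotheses (ak_gt0 : 0 < a k) (an_gt0 : 0 < a n).
Hypotheses (devk : pr (dev k t) <= p) (devn : pr (dev n t) <= p).

(** Otherwise, sums close to both radii would force the tail to have norm at least [a k + t], which
    is too unlikely. *)
Lemma final_radius_le : a n <= 2 * a k + 3 * t.
Proof.
have [//|far] := leP; exfalso.
pose c := a k + t.
pose B : set ('I_n -> borel_space H) := [set x | c <= `|tail_sum k x|].
have mB : (cylinder full).-sigma.-measurable B by exact: mnorm (mray c).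
have prB : pr B <= 2 * p.
  (* Reversal turns the tail into an initial sum of at most [k] terms, controlled by the sum at time
     [k]. *)
  rewrite /pr -mu_reverse//.
  have -> : [set x : 'I_n -> borel_space H | B (reverse x)] =
      [set x | c <= `|head_sum (n - k) x|].
    by apply/seteqP; split => x; rewrite /B /= tail_sum_reverse.
  apply: le_trans (prob_head_sum_mono c (_ : n - k <= k)%N) _; first lia.
  rewrite ler_pM2l//; apply: le_trans devk.
  apply: le_fine_prob => // x; rewrite /dev /c /= => cx.
  by rewrite ler_normr; apply/orP; left; lra.
have mU := measurableU _ _ (mdev n t) (mdev k t).
(* These three events would cover the whole space, yet their total probability is at most
   [p + p + 2 * p < 1]. *)
have : pr setT <= pr (dev n t `|` dev k t `|` B).
  apply: le_fine_prob => //; first exact: measurableU.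
  move=> x _.
  have [|] := leP t `| `|head_sum n x| - a n|; first by left; left.
  have [|] := leP t `| `|head_sum k x| - a k|; first by left; right.
  have [|] := leP c `|tail_sum k x|; first by right.
  rewrite !ltr_norml => Bx /andP[_ kx] /andP[nx _]; exfalso.
  have := ler_normD (head_sum k x) (tail_sum k x).
  by rewrite -head_tail_sum; rewrite /c in Bx; lra.
rewrite {1}/pr probability_setT /=.
have := fine_probU mu mU mB; have := fine_probU mu (mdev n t) (mdev k t).
move: prB devk devn p_small; rewrite /pr; lra.
Qed.

(** The bounds of [typical_increment] with [b = a n]; they constrain the tail alone, so the event is
    independent of the first [k] coordinates. *)
Let typical : set ('I_n -> borel_space H) :=
  [set x | Num.max 0 (a n - t) ^+ 2 - (a k + t) ^+ 2 <= `|tail_sum k x| ^+ 2 <=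
    (a n + t) ^+ 2 - Num.max 0 (a k - t) ^+ 2].

Let measurable_typical (J : {set 'I_n}) :
  (forall j : 'I_n, ~~ (j < k)%N -> j \in J) ->
  (cylinder J).-sigma.-measurable typical.
Proof. by move=> kJ; exact: measurable_norm_sum (measurable_sqr_itv _ _). Qed.

Let flipped : set ('I_n -> borel_space H) := [set x | dev n t (flip_from k x)].

Let mflipped : (cylinder full).-sigma.-measurable flipped.
Proof. exact: measurable_flip. Qed.

Let flippedE x : flipped x <-> t <= `| `|head_sum k x - tail_sum k x| - a n|.
Proof.
by rewrite /flipped /dev /= (head_tail_sum k) head_sum_flip// tail_sum_flip.
Qed.

(** Outside three exceptional events [typical_increment] applies. Each has probability at most [p];
    for [flipped] this follows from flip invariance. *)
Lemma prob_typical : 1 - 3 * p <= pr typical.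
Proof.
have mtyp : (cylinder full).-sigma.-measurable typical.
  by apply: measurable_typical => j _; exact: finset.in_setT.
have mU := measurableU _ _ (mdev n t) (mdev k t).
have : pr (~` typical) <= pr (dev n t `|` dev k t `|` flipped).
  apply: le_fine_prob; [exact: measurableC|exact: measurableU|].
  move=> x ntyp.
  have [|nx] := leP t `| `|head_sum n x| - a n|; first by left; left.
  have [|kx] := leP t `| `|head_sum k x| - a k|; first by left; right.
  have [|fx] := leP t `| `|head_sum k x - tail_sum k x| - a n|.
    by move=> /flippedE; right.
  exfalso; apply: ntyp; move: nx; rewrite (head_tail_sum k) => nx.
  exact: typical_increment (parallelogram _ _ hilbertH) kx nx fx.
have := fine_probU mu mU mflipped; have := fine_probU mu (mdev n t) (mdev k t).
have -> : fine (mu flipped) = pr (dev n t).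
  by congr fine; exact: mu_flip.
rewrite /pr fine_probC//; move: devk devn; rewrite /pr; lra.
Qed.

(* Conditionally on [A], the sums with increment [y] and [- y] are equally
   likely, and for a typical [y] at least one of them is atypical. *)
Lemma prob_exit_persists (A : set ('I_n -> borel_space H)) :
  (cylinder [set j : 'I_n | (j < k)%N]%SET).-sigma.-measurable A ->
  A `<=` dev k (19 * t) -> pr A <= 4 * pr (A `&` dev n t).
Proof.
move=> mA Adev.
have mA' : (cylinder full).-sigma.-measurable A.
  by apply: measurable_cylinder_sub mA; apply/fintype.subsetP => j _; exact: finset.in_setT.
have mtyp : (cylinder full).-sigma.-measurable typical.
  by apply: measurable_typical => j _; exact: finset.in_setT.
have prAt : pr (A `&` typical) = pr A * pr typical.
  rewrite /pr (mu_indep (K := ~: [set j : 'I_n | (j < k)%N]%SET) _ mA).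
  - by rewrite fineM// fin_num_measure.
  - by rewrite -finset.setI_eq0 finset.setICr.
  - by apply: measurable_typical => j; rewrite !inE.
have Afix : [set x : 'I_n -> borel_space H | A (flip_from k x)] = A.
  apply: (@preimage_fix_coords _ _ (borel_space H) _ (flip_from k) A _ mA) => x j.
  by rewrite inE /flip_from => ->.
(* [A] is unchanged by the flip, which exchanges [dev n t] and [flipped]. *)
have prAf : pr (A `&` flipped) = pr (A `&` dev n t).
  rewrite /pr -[in RHS](mu_flip k); last exact: measurableI.
  by congr (fine (mu _)); rewrite -[in LHS]Afix.
have : pr (A `&` typical) <= pr ((A `&` dev n t) `|` (A `&` flipped)).
  apply: le_fine_prob; [exact: measurableI|by apply: measurableU; exact: measurableI|].
  move=> x [Ax /= typx].
  have := atypical_position (normr_ge0 (head_sum k x)) (normr_ge0 _) (normr_ge0 _)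
    t_gt0 ak_gt0 an_gt0 (parallelogram _ _ hilbertH) final_radius_le
    (Adev _ Ax) typx.
  rewrite -head_tail_sum => -[nx|fx]; first by left.
  by right; split=> //; apply/flippedE.
have := fine_probU mu (measurableI _ _ mA' (mdev n t)) (measurableI _ _ mA' mflipped).
rewrite -![fine _]/(pr _) prAf prAt.
have A0 : 0 <= pr A by exact: fine_ge0.
have := ler_wpM2l A0 prob_typical.
(* Since [3 * p < 1 / 2], at least half of [A] is typical. That half is covered by two events of
   equal probability, whence the factor [4]. *)
have : pr A * (1 / 2) <= pr A * (1 - 3 * p).
  apply: ler_wpM2l => //; move: p_small; lra.
lra.
Qed.

End one_step.

(** Splitting by the first exit time gives disjoint events, each determined by the past. Summing the
    one-step bounds leaves disjoint parts of [dev n t]. *)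
Lemma prob_exists_exit (i : nat) : (n <= 2 * i)%N ->
  (forall k, (i <= k <= n)%N -> 0 < a k) -> (i <= n)%N ->
  (forall k, (i <= k <= n)%N -> pr (dev k t) <= p) ->
  pr (\bigcup_(k in [set k | (i <= k <= n)%N]) dev k (19 * t)) <= 4 * p.
Proof.
move=> ni a_gt0 i_le devp.
(* Empty sets before time [i] let [seqDU], which starts at [0], pick out the first exit. *)
pose F k : set ('I_n -> borel_space H) :=
  if (i <= k <= n)%N then dev k (19 * t) else set0.
have mF k (J : {set 'I_n}) : (forall j : 'I_n, (j < k)%N -> j \in J) ->
    (cylinder J).-sigma.-measurable (F k).
  by move=> kJ; rewrite /F; case: ifP => // _; exact: measurable_dev.
pose A := seqDU F.
have mA k (J : {set 'I_n}) : (forall j : 'I_n, (j < k)%N -> j \in J) ->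
    (cylinder J).-sigma.-measurable (A k).
  move=> kJ; apply: measurableD; first exact: mF.
  apply: bigsetU_measurable => l _; apply: mF => j jl.
  by apply: kJ; exact: ltn_trans jl (ltn_ord l).
have mAfull k : (cylinder full).-sigma.-measurable (A k).
  by apply: mA => j _; exact: finset.in_setT.
have -> : \bigcup_(k in [set k | (i <= k <= n)%N]) dev k (19 * t) =
    \big[setU/set0]_(k < n.+1) A k.
  rewrite /A -bigsetU_seqDU -(bigcup_mkord n.+1 F); apply/seteqP; split => x [k /= kn].
    by move=> kx; exists k; rewrite /F /= ?kn//; case/andP: kn => _; rewrite ltnS.
  by rewrite /F; case: ifP => // ikn kx; exists k.
rewrite [pr _]fine_prob_bigsetU//; last exact: trivIset_seqDU.
apply: (@le_trans _ _ (\sum_(k < n.+1) 4 * pr (A k `&` dev n t))).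
  apply: ler_sum => k _; have [ikn|ikn] := boolP (i <= k <= n)%N; last first.
    have -> : A k = set0 by apply/seteqP; split => // x [+ _]; rewrite /F (negbTE ikn).
    by rewrite set0I /pr measure0 /= mulr0.
  have [ik kn] := andP ikn.
  apply: (@prob_exit_persists k) => //.
  - by rewrite (leq_trans ni)// leq_mul2l.
  - exact: a_gt0.
  - by apply: a_gt0; rewrite i_le leqnn.
  - exact: devp.
  - by apply: devp; rewrite i_le leqnn.
  - by apply: mA => j jk; rewrite inE.
  - by move=> x [+ _]; rewrite /F ikn.
rewrite -mulr_sumr ler_pM2l//.
rewrite -(fine_prob_bigsetU mu (F := fun k => A k `&` dev n t)); first last.
- by apply: trivIset_setIr; exact: trivIset_seqDU.
- by move=> k; exact: measurableI.
apply: (@le_trans _ _ (pr (dev n t))); last by apply: devp; rewrite i_le leqnn.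
apply: le_fine_prob => //.
  by apply: bigsetU_measurable => k _; exact: measurableI.
by rewrite -(bigcup_mkord _ (fun k => A k `&` dev n t)) => x [k _ []].
Qed.

End maximal_inequality.

(** * Transfer to the original probability space *)

Lemma le_bigmax_has (R : realType) (s : seq nat) (f : nat -> R) (c : R) :
  0 < c -> (c <= \big[Num.max/0]_(k <- s) f k) = has (fun k => c <= f k) s.
Proof.
(* The default value [0] lies below [c], so it never attains the bound. *)
move=> c0; elim: s => [|k s IH]; first by rewrite big_nil leNgt c0.
by rewrite big_cons le_max IH.
Qed.

Unset Implicit Arguments.
Set Strict Implicit.

(* Both maxima range over a nonempty set of nonnegative values, so the base
   value 0 of the big operators does not affect them. *)
Theorem corollary1p4 (R : realType) (d : measure_display)
    (Omega : measurableType d) (P : probability Omega R)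
    (H : completeNormedModType R)
    (hilbertH : hilbert_norm H) (separableH : separable_space H)
    (n : nat) (n_ge1 : (1 <= n)%N)
    (X : 'I_n -> {RV P >-> borel_space H})
    (X_indep : mutually_independent P (fun j => X j : Omega -> borel_space H))
    (X_ident : forall j k : 'I_n, same_law P (X j) (X k))
    (X_symm : forall j : 'I_n, symmetric_vector P (X j))
    (i : nat) (i_ge : n%:R / 2 <= i%:R :> R) (i_le : (i <= n)%N)
    (a : nat -> R) (a_gt0 : forall k : nat, (i <= k <= n)%N -> 0 < a k)
    (t : R) (t_ge0 : 0 <= t) :
  let S : nat -> Omega -> H :=
    partial_sum (fun (j : 'I_n) (w : Omega) => X j w : H) in
  (P [set w | (19 * t <=
       \big[Num.max/0]_(i <= k < n.+1) `| `|S k w| - a k |)%R] <=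
   6%:E * \big[maxe/0]_(i <= k < n.+1)
            P [set w | (t <= `| `|S k w| - a k |)%R])%E.
Proof.
cbv zeta; set S := partial_sum _.
set q := (\big[maxe/0]_(_ <= _ < _) _)%E.
set event := [set w | _].
have mX j : measurable_fun setT (X j : Omega -> borel_space H) by exact: measurable_funPT.
(* The vectors are gathered into one random path, whose law is [mu]. *)
pose joint : {RV P >-> g_sigma_algebraType
    (cylinder (E := borel_space H) [set: 'I_n]%SET)} :=
  mfun_Sub (mem_set (measurable_family (J := [set: 'I_n]%SET)
    (f := fun w j => X j w) (fun j _ => mX j))).
pose mu := distribution P joint.
pose C k (c : R) : set ('I_n -> borel_space H) :=
  [set x | c <= `| `|head_sum k x| - a k|].
have mC k c : (cylinder (E := borel_space H) [set: 'I_n]%SET).-sigma.-measurable (C k c).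
  by apply: measurable_dev => // j _; exact: finset.in_setT.
have q_ge k : (i <= k <= n)%N -> (mu (C k t) <= q)%E.
  move=> ikn; rewrite /q.
  by apply: (@le_bigmax_seq _ _ _ _ _ k xpredT (fun k => mu (C k t))) => //;
    rewrite mem_index_iota ltnS.
have q_ge0 : (0 <= q)%E.
  by apply: le_trans (q_ge n _); rewrite ?i_le ?leqnn.
pose U := \bigcup_(k in [set k | (i <= k <= n)%N]) C k (19 * t).
have mU : (cylinder (E := borel_space H) [set: 'I_n]%SET).-sigma.-measurable U.
  by apply: bigcup_measurable => k _; exact: mC.
have eventE : 0 < t -> event = joint @^-1` U.
  move=> t_gt0; have t19 : 0 < 19 * t by lra.
  apply/seteqP; split => w; rewrite /event /= le_bigmax_has//.
    by case/hasP => k; rewrite mem_index_iota ltnS => ikn kt; exists k.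
  by case=> k /= ikn kt; apply/hasP; exists k => //; rewrite mem_index_iota ltnS.
(* For [q >= 1/6] the right-hand side is at least [1]; the constant [6] comes from this case. *)
have [q6|q6] := leP (6^-1)%:E q.
  have mevent : measurable event.
    move: t_ge0; rewrite le_eqVlt => /predU1P[t0|/eventE ->].
      have -> : event = setT; last by exact: measurableT.
      apply/seteqP; split => // w _; rewrite /event /= -t0 mulr0.
      by elim/big_ind : _ => // x y x0 y0; rewrite le_max x0.
    by rewrite -[X in measurable X]setTI; exact: measurable_funPT.
  apply: le_trans (probability_le1 P mevent) _.
  have -> : 1%E = (6%:E * (6^-1)%:E : \bar R)%E by rewrite -EFinM divff.
  by rewrite lee_pmul2l.
have qfin : q \is a fin_num by rewrite ge0_fin_numE// (lt_trans q6)// ltry.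
(* If [t = 0], the event at time [n] is the whole space, so [q >= 1], against [q < 1/6]. *)
move: t_ge0; rewrite le_eqVlt => /predU1P[t0|t_gt0].
  exfalso; move: q6; apply/negP; rewrite -leNgt.
  apply: le_trans (q_ge n _); last by rewrite i_le leqnn.
  have -> : mu (C n t) = 1%E.
    rewrite -(probability_setT mu); congr (mu _).
    by apply/seteqP; split => // x _; rewrite /C /= -t0.
  by rewrite lee_fin invf_le1// ler1n.
have -> : P event = (fine (mu U))%:E.
  by rewrite fineK ?fin_num_measure// eventE.
rewrite -(fineK qfin) -EFinM lee_fin.
have i2 : (n <= 2 * i)%N.
  by rewrite -(ler_nat R) natrM; lra.
(* The path-space bound has the constant [4], which is weakened using [q >= 0]. *)
suff : fine (mu U) <= 4 * fine q by have := fine_ge0 q_ge0; lra.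
have q_lt : fine q < 1 / 6 by rewrite -lte_fin fineK// div1r.
apply: (@prob_exists_exit R H n hilbertH separableH mu _ _ _ a t (fine q)) => //.
- move=> k B mB.
  (* Flip invariance: negating some of the vectors preserves independence and, by symmetry, each
     marginal. *)
  pose g (j : 'I_n) (y : borel_space H) : borel_space H :=
    if (j < k)%N then y else - (y : H).
  have mg j : measurable_fun setT (g j).
    by rewrite /g; case: (j < k)%N; [exact: measurable_id|exact: measurable_oppv].
  apply/esym; apply: (eq_joint_law (Y := fun j w => g j (X j w))) => //.
  + by move=> j; exact: measurableT_comp (mg j) (mX j).
  + exact: mutually_independent_comp.
  + by move=> j; rewrite /g; case: (j < k)%N => //; exact: X_symm.
(* Reversal invariance: permuting the family preserves independence, and the marginals all
   coincide. *)
- move=> B mB; apply/esym.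
  apply: (eq_joint_law (Y := fun j => X (rev_ord j) : Omega -> borel_space H)) => //.
  exact: mutually_independent_reindex rev_ordK X_indep.
- by move=> J K B D JK mB mD; exact: (indep_blocks mX X_indep JK mB mD).
- by move=> k ikn; apply: fine_le; rewrite ?fin_num_measure//; [exact: mC|exact: q_ge].
Qed.
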